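(* Let $s\ge 1$ and $n>1$ be integers, and let $A$ be a commutative ring with identity in which $-1$ is not a sum of squares. Then $p_{2s}(A[x_1,\dots,x_n])=\infty$.
   Context: For a commutative ring $A$ with identity and a positive integer $m$, the $m$-th Pythagoras number $p_m(A)$ is the least positive integer $\ell$ such that every element of $A$ that is a sum of $m$-th powers of elements of $A$ can be written as a sum of at most $\ell$ $m$-th powers of elements of $A$; if no such $\ell$ exists, $p_m(A)=\infty$. *)

(* Defs.v *)
From mathcomp Require Import all_boot all_algebra.
From mathcomp Require Export mpoly.

Set Implicit Arguments.
Unset Strict Implicit.
Unset Printing Implicit Defensive.

Import GRing.Theory.
Local Open Scope ring_scope.

Definition sum_of_powers (R : comNzRingType) (m : nat) (x : R) : Prop :=
  exists l : seq R, x = \sum_(y <- l) y ^+ m.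

Definition sum_of_at_most_powers (R : comNzRingType) (m k : nat) (x : R) : Prop :=
  exists l : seq R, (size l <= k)%N /\ x = \sum_(y <- l) y ^+ m.

(* k is an admissible bound for the m-th Pythagoras number of R: every sum of
   m-th powers is a sum of at most k m-th powers. p_m(R) is the least positive
   such k. *)
Definition pythagoras_bound (R : comNzRingType) (m k : nat) : Prop :=
  forall x : R, sum_of_powers m x -> sum_of_at_most_powers m k x.

Definition pythagoras_infinite (R : comNzRingType) (m : nat) : Prop :=
  forall k : nat, (0 < k)%N -> ~ pythagoras_bound R m k.

(* Main.v *)
(** The real radical of [0] in [A], i.e. the set of [x] such that [- x ^ (2 n)]
    is a sum of squares for some [n], is an ideal, proper because [-1] is not a
    sum of squares.  In the quotient [B], a sum of [2s]-th powers vanishes only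
    if every term does.

    Let [N_i = \prod_(j <= k, j != i) (X - j)].  The polynomial
    [\sum_i (N_i(x) N_i(y)) ^ (2s)] is not a sum of fewer than [k + 1] powers,
    even over [B].  If it equals [\sum_j g_j ^ (2s)], then comparing restrictions
    to the lines [y = b] and [x = a] gives [g_j(x, b) = h_jb N_b(x)] and
    [g_j(a, y) = k_ja N_a(y)].  Differentiating in [y] at [y = b], dividing by
    [N_b(x) ^ (2s - 1)] and setting [x = a] yields
    [\sum_j h_jb ^ (2s - 1) k_ja = 0] for [a != b], while the same sum for [a = b]
    is a nonzero integer.  So the matrix [(k_ja)] has no zero row. *)
Require Import Defs.
From HB Require Import structures.
From mathcomp Require Import all_boot all_algebra.
From mathcomp Require Import mpoly ssrcomplements.
From mathcomp Require Import ring zify.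
From mathcomp Require Import generic_quotient.
From mathcomp Require boolp.
Import GRing.Theory.
Local Open Scope ring_scope.

(** * Sums of squares and the real radical of zero *)

Section SumsOfSquares.
Variable A : comNzRingType.
Implicit Types x y : A.
Local Notation sos := (@sum_of_powers A 2).

Lemma sos0 : sos 0.
Proof. by exists [::]; rewrite big_nil. Qed.

Lemma sos_sqr x : sos (x ^+ 2).
Proof. by exists [:: x]; rewrite big_seq1. Qed.

Lemma sosD x y : sos x -> sos y -> sos (x + y).
Proof. by move=> [l ->] [r ->]; exists (l ++ r); rewrite big_cat. Qed.

Lemma sos_sum (I : Type) (r : seq I) (F : I -> A) :
  (forall i, sos (F i)) -> sos (\sum_(i <- r) F i).
Proof. by move=> sosF; apply: big_ind => //; [exact: sos0 | exact: sosD]. Qed.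

Lemma sosMn x n : sos x -> sos (x *+ n).
Proof.
by move=> sx; rewrite -[n]card_ord -sumr_const; apply: sos_sum.
Qed.

Lemma sosM x y : sos x -> sos y -> sos (x * y).
Proof.
move=> [l ->] [r ->]; rewrite mulr_suml; apply: sos_sum => a.
rewrite mulr_sumr; apply: sos_sum => b.
by rewrite -exprMn; apply: sos_sqr.
Qed.

Lemma sosX x n : sos x -> sos (x ^+ n).
Proof.
move=> sx; elim: n => [|n IHn]; last by rewrite exprS; apply: sosM.
by have := sos_sqr 1; rewrite expr1n expr0.
Qed.

Lemma sos_exprD x y n : sos x -> sos y -> exists2 z, sos z & (x + y) ^+ n = x ^+ n + z.
Proof.
move=> sx sy; rewrite exprDn big_ord_recl subn0 expr0 mulr1 bin0 mulr1n.
eexists; last by [].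
by apply: sos_sum => i; apply/sosMn/sosM; apply: sosX.
Qed.

Definition real_nil {A : comNzRingType} (x : A) : Prop :=
  exists n, sum_of_powers 2 (- (x ^+ 2) ^+ n).

Lemma real_nil0 : real_nil (0 : A).
Proof. by exists 1; rewrite expr1 expr0n oppr0; apply: sos0. Qed.

Lemma real_nilMl x y : real_nil y -> real_nil (x * y).
Proof.
move=> [n sy]; exists n; rewrite (exprMn 2) exprMn -mulrN.
by apply: sosM => //; apply/sosX/sos_sqr.
Qed.

(** Each binomial term contains [y ^+ n] (when [i > n]) or [x ^+ m] (when [i <= n]), and that factor
    absorbs the minus sign. *)
Lemma sosN_exprD x y m n : sos x -> sos y -> sos (- x ^+ m) -> sos (- y ^+ n) ->
  sos (- (x + y) ^+ (m + n)).
Proof.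
move=> sx sy sxm syn; rewrite exprDn -sumrN; apply: sos_sum => i.
rewrite -mulNrn; apply: sosMn; have [lt_n_i | le_i_n] := ltnP n i.
  rewrite -{2}(subnK (ltnW lt_n_i)) exprD mulrA -mulrN.
  by apply: sosM => //; apply: sosM; apply: sosX.
rewrite -addnBA // addnC exprD -mulrA mulrCA -mulNr.
by apply: sosM => //; apply: sosM; apply: sosX.
Qed.

(* (x + y)^2 + (x - y)^2 = 2 (x^2 + y^2) *)
Lemma real_nilD x y : real_nil x -> real_nil y -> real_nil (x + y).
Proof.
move=> [m sx] [n sy]; exists (m + n)%N.
have [z sz Dz] := sos_exprD _ _ (m + n) (sos_sqr (x + y)) (sos_sqr (x - y)).
have par : (x + y) ^+ 2 + (x - y) ^+ 2 = (x ^+ 2 + y ^+ 2) * 2%:R.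
  by ring.
(* [z] gathers the binomial terms involving [(x - y) ^+ 2]; adding it leaves only the power of
   [(x + y) ^+ 2]. *)
have -> : - ((x + y) ^+ 2) ^+ (m + n) = - ((x ^+ 2 + y ^+ 2) ^+ (m + n)) * 2%:R ^+ (m + n) + z.
  by rewrite mulNr -exprMn -par Dz opprD subrK.
apply: sosD => //; apply: sosM; last by apply/sosX/sosMn; have := sos_sqr 1; rewrite expr1n.
by apply: sosN_exprD => //; apply: sos_sqr.
Qed.

(** Expanding the power of the sum around its [j]-th term leaves a remainder [t] that is a sum of
    squares; adding [t] back isolates minus a power of [y j]. *)
Lemma real_nil_sum_powers (s k : nat) (y : 'I_k -> A) :
  real_nil (\sum_j y j ^+ (2 * s)) -> forall j, real_nil (y j).
Proof.
move=> [n sn] j; exists (s * (2 * n))%N.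
have [||t st Dt] := sos_exprD (y j ^+ (2 * s)) (\sum_(i | i != j) y i ^+ (2 * s)) (2 * n).
- by rewrite exprM; apply/sosX/sos_sqr.
- rewrite big_mkcond; apply: sos_sum => i; case: ifP => _; last exact: sos0.
  by rewrite exprM; apply/sosX/sos_sqr.
move: sn; rewrite (bigD1 j) //= -exprM Dt opprD -!exprM => sn.
by rewrite mulnA -[X in sos X](subrK t); apply: sosD.
Qed.

End SumsOfSquares.

(** * The anisotropic quotient *)

Definition powers_anisotropic (B : comNzRingType) (m : nat) : Prop :=
  forall (k : nat) (y : 'I_k -> B), \sum_j y j ^+ m = 0 -> forall j, y j = 0.

Section Quotient.
Variables (A : comNzRingType) (hA : ~ sum_of_powers 2 (-1 : A)).

(** Ideals are boolean predicates, hence [asbool]. The argument carries properness, so that the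
    ideal instance can be inferred from the term. *)
Definition real_nil_pred (_ : ~ sum_of_powers 2 (-1 : A)) : A -> bool :=
  fun x => boolp.asbool (real_nil x).

Lemma real_nilP x : reflect (real_nil x) (real_nil_pred hA x).
Proof. exact: boolp.asboolP. Qed.

Lemma real_nil_idealr_closed : idealr_closed (real_nil_pred hA).
Proof.
split.
- exact/real_nilP/real_nil0.
- by apply/real_nilP => -[n]; rewrite !expr1n.
move=> a x y /real_nilP nx /real_nilP ny.
by apply/real_nilP/real_nilD => //; apply: real_nilMl.
Qed.

HB.instance Definition _ :=
  isIdealr.Build A (real_nil_pred hA) real_nil_idealr_closed.

Lemma anisotropic_quotient (s : nat) :
  exists (B : comNzRingType) (phi : {rmorphism A -> B}), powers_anisotropic B (2 * s).
Proof.
pose I : idealr A := real_nil_pred hA; pose B := {ideal_quot I}.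
pose phi : {rmorphism A -> B} := \pi_B%qT.
have phi_eq0 x : phi x = 0 <-> real_nil x.
  have -> : phi x = 0 <-> phi x == phi 0 by rewrite rmorph0; exact: (rwP eqP).
  by rewrite -(Quotient.idealrBE I) subr0; apply: iff_sym; apply: (rwP (real_nilP x)).
exists B, phi => k y y0 j.
rewrite -[y j]reprK; apply/phi_eq0.
apply: (real_nil_sum_powers A s k (fun j => repr (y j))); apply/phi_eq0.
rewrite rmorph_sum -[RHS]y0; apply: eq_bigr => i _.
by rewrite rmorphXn; congr (_ ^+ _); exact: reprK.
Qed.
End Quotient.

(** * Top coefficients of products and powers *)

Lemma coefM_top (R : comNzRingType) (p q : {poly R}) (d e : nat) :
  (size p <= d.+1)%N -> (size q <= e.+1)%N -> (p * q)`_(d + e) = p`_d * q`_e.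
Proof.
move=> sp sq; rewrite coefM.
have lt_d : (d < (d + e).+1)%N by rewrite ltnS leq_addr.
rewrite (bigD1 (Ordinal lt_d)) //= addKn big1 ?addr0 // => i /eqP ne_i.
have [lt_id | lt_di | eq_id] := ltngtP i d.
- rewrite [q`__]nth_default ?mulr0 //; apply: leq_trans sq _; lia.
- by rewrite [p`__]nth_default ?mul0r //; apply: leq_trans sp _.
- by case: ne_i; apply: val_inj.
Qed.

Lemma size_exp_bound (R : comNzRingType) (p : {poly R}) (d m : nat) :
  (size p <= d.+1)%N -> (size (p ^+ m) <= (m * d).+1)%N.
Proof.
move=> sp; apply: leq_trans (size_poly_exp_leq _ _) _.
by rewrite ltnS mulnC leq_mul2l; apply/orP; right; rewrite -ltnS; case: (size p) sp.
Qed.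

Lemma coefX_top (R : comNzRingType) (p : {poly R}) (d m : nat) :
  (size p <= d.+1)%N -> (p ^+ m)`_(m * d) = p`_d ^+ m.
Proof.
move=> sp; elim: m => [|m IHm]; first by rewrite mul0n !expr0 coef1.
by rewrite mulSn !exprS coefM_top ?IHm //; apply: size_exp_bound.
Qed.

(** * Sums of powers of polynomials over an anisotropic ring *)

Section Anisotropic.
Variables (B : comNzRingType) (m : nat) (m_gt1 : (1 < m)%N).
Hypothesis B_aniso : powers_anisotropic B m.

Let m_gt0 : (0 < m)%N := ltnW m_gt1.

(** [B] may have zero divisors, so every later cancellation goes through regularity. Here, if [n.+1]
    kills [x], then [n.+1] copies of [x ^+ m] sum to 0. *)
Lemma natr_lreg (n : nat) : GRing.lreg (n.+1%:R : B).
Proof.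
apply: mulrI0_lreg => x nx0.
apply: (B_aniso n.+1 (fun=> x) _ ord0).
by rewrite sumr_const card_ord -(prednK m_gt0) exprS -mulr_natl mulrA nx0 mul0r.
Qed.

Lemma natrB_lreg (i j : nat) : i != j -> GRing.lreg (i%:R - j%:R : B).
Proof.
wlog lt_ij : i j / (i < j)%N => [IH|_].
  move=> ne; have [lt_ij | lt_ji] := boolP (i < j)%N; first exact: IH.
  rewrite -opprB; apply/lregN/IH; last by rewrite eq_sym.
  by rewrite ltn_neqAle eq_sym ne leqNgt.
rewrite -opprB -natrB; last exact: ltnW.
by rewrite -subn_gt0 in lt_ij; rewrite -(prednK lt_ij); apply/lregN/natr_lreg.
Qed.

(** Top coefficients cannot cancel: their [m]-th powers sum to a coefficient of positive degree of
    [c%:P], which is 0. So a common degree bound descends to 0. *)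
Lemma sum_powers_const (k : nat) (p : 'I_k -> {poly B}) (c : B) :
  \sum_j p j ^+ m = c%:P -> forall j, exists h, p j = h%:P.
Proof.
move=> sum_p.
suff: forall d, (forall j, size (p j) <= d.+1)%N -> (forall j, size (p j) <= 1)%N.
  move=> /(_ (\max_j size (p j))) bnd j; exists (p j)`_0; apply: size1_polyC; apply: bnd => i.
  exact/leqW/(leq_bigmax (F := fun j => size (p j))).
elim=> // d IHd sp; apply: IHd => j.
rewrite leqNgt; apply/negP => lt_dp.
have szj : size (p j) = d.+2 by apply/eqP; rewrite eqn_leq sp.
have := B_aniso k (fun j => (p j)`_d.+1) _ j.
have -> : \sum_j (p j)`_d.+1 ^+ m = 0.
  transitivity (\sum_j (p j ^+ m)`_(m * d.+1)).
    by apply: eq_bigr => i _; rewrite coefX_top.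
  by rewrite -coef_sum sum_p coefC muln_eq0 -leqn0 leqNgt m_gt0.
move=> /(_ erefl) /eqP; rewrite -[d.+1]/(d.+2.-1) -szj -lead_coefE lead_coef_eq0.
by rewrite -size_poly_eq0 szj.
Qed.

(** At a root of the right side anisotropy makes every [p j] vanish; the linear factor is monic, so
    its [m]-th power cancels, and induction ends in the constant case. *)
Lemma sum_powers_divides (k : nat) (I : Type) (r : seq I) (P : pred I) (e : I -> B)
    (p : 'I_k -> {poly B}) (c : B) :
  \sum_j p j ^+ m = c%:P * (\prod_(i <- r | P i) ('X - (e i)%:P)) ^+ m ->
  forall j, exists h, p j = h%:P * \prod_(i <- r | P i) ('X - (e i)%:P).
Proof.
elim: r p => [|i r IHr] p.
  by rewrite big_nil expr1n mulr1 => /sum_powers_const sp j; have [h ->] := sp j;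
     exists h; rewrite mulr1.
rewrite big_cons; case: ifP => [_|_]; last exact: IHr.
set L := 'X - _; move=> sum_p.
have Lreg : GRing.lreg (L ^+ m) by apply/lregX/monic_lreg/monicXsubC.
have root_p j : exists q, p j = q * L.
  apply/factor_theorem/rootP; move: j; apply: B_aniso.
  transitivity (\sum_j p j ^+ m).[e i].
    by rewrite horner_sum; apply: eq_bigr => j _; rewrite horner_exp.
  by rewrite sum_p hornerM horner_exp hornerM hornerXsubC subrr mul0r expr0n gtn_eqF // mulr0.
have [q Dp] := fin_all_exists root_p.
have /IHr sum_q : \sum_j q j ^+ m = c%:P * (\prod_(i <- r | P i) ('X - (e i)%:P)) ^+ m.
  apply: Lreg; rewrite mulrCA -exprMn -sum_p mulr_sumr; apply: eq_bigr => j _.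
  by rewrite Dp -exprMn mulrC.
by move=> j; have [h Dq] := sum_q j; exists h; rewrite Dp Dq -mulrA (mulrC L).
Qed.

(** * Nodal polynomials and nonvanishing of the summands *)

Section Nodes.
Variable d : nat.

(** Unnormalised Lagrange basis on the nodes 0, ..., [d]. Ring and point are arbitrary, so one
    formula gives the polynomials in either variable and their values. *)
Definition nodal (R : comNzRingType) (x : R) (i : 'I_d.+1) : R :=
  \prod_(j < d.+1 | j != i) (x - j%:R).

Lemma rmorph_nodal (R S : comNzRingType) (f : {rmorphism R -> S}) (x : R) (i : 'I_d.+1) :
  f (nodal R x i) = nodal S (f x) i.
Proof.
rewrite /nodal rmorph_prod; apply: eq_bigr => j _.
by rewrite rmorphB rmorph_nat.
Qed.

Lemma nodal_eq0 (R : comNzRingType) (i j : 'I_d.+1) : j != i -> nodal R j%:R i = 0.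
Proof. by move=> ne; rewrite /nodal (bigD1 j) //= subrr mul0r. Qed.

Lemma nodalX (R : comNzRingType) (i : 'I_d.+1) :
  nodal {poly R} 'X i = \prod_(j < d.+1 | j != i) ('X - (j%:R)%:P).
Proof. by apply: eq_bigr => j _; rewrite polyC_natr. Qed.

Lemma monic_nodal (R : comNzRingType) (i : 'I_d.+1) : nodal {poly R} 'X i \is monic.
Proof. by rewrite nodalX monic_prod_XsubC. Qed.

Lemma horner_nodal (R : comNzRingType) (x : R) (i : 'I_d.+1) :
  (nodal {poly R} 'X i).[x] = nodal R x i.
Proof. by rewrite -horner_evalE rmorph_nodal /= horner_evalE hornerX. Qed.

Lemma nodal_lreg (i : 'I_d.+1) : GRing.lreg (nodal B i%:R i).
Proof. by apply: lreg_prod => j _ ne; apply: natrB_lreg; rewrite eq_sym. Qed.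

(** [b] is a simple root, so the derivative there is the product of the remaining differences of
    distinct nodes. *)
Lemma deriv_nodal_lreg (i b : 'I_d.+1) :
  b != i -> GRing.lreg ((nodal {poly B} 'X i)^`().[b%:R]).
Proof.
move=> ne; rewrite nodalX (bigD1 b) //= derivM derivXsubC mul1r hornerD.
rewrite [X in _ + X]hornerM hornerXsubC subrr mul0r addr0 horner_prod.
apply: lreg_prod => j _ /andP[_ ne_jb]; rewrite hornerXsubC.
by apply: natrB_lreg; rewrite eq_sym.
Qed.

(** The determinant of the product is regular, hence nonzero, whereas a zero row would give
    [\det K = 0]. *)
Lemma diag_mx_singular (R : comNzRingType) (n : nat) (H K : 'M[R]_n) (i0 : 'I_n) :
  (forall a b, a != b -> (H *m K) a b = 0) -> (forall a, GRing.lreg ((H *m K) a a)) ->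
  row i0 K != 0.
Proof.
move=> offdiag diag_lreg; apply/eqP => K0.
have : GRing.lreg (\det (H *m K)).
  have -> : H *m K = diag_mx (\row_a (H *m K) a a).
    apply/matrixP => a b; rewrite [RHS]mxE [in RHS]mxE.
    by have [->|ne] := eqVneq a b; rewrite ?mulr1n // mulr0n offdiag.
  by rewrite det_diag; apply: lreg_prod => a _ _; rewrite mxE.
move/lreg_neq0/eqP; case; rewrite det_mulmx (expand_det_row K i0) big1 ?mulr0 // => j _.
by have /rowP/(_ j) := K0; rewrite !mxE => ->; rewrite mul0r.
Qed.

Variable g : 'I_d.+1 -> {poly {poly B}}.
Hypothesis sum_g :
  \sum_j g j ^+ m = \sum_i (nodal _ 'X%:P i * nodal _ 'X i) ^+ m.

(** The outer variable is y and the inner one, ['X%:P], is x: [gx b] restricts to y = b and [gy a]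
    to x = a. *)
Let gx (b : 'I_d.+1) j : {poly B} := (g j).[b%:R].
Let gy (a : 'I_d.+1) j : {poly B} := map_poly (horner_eval a%:R) (g j).

Lemma horner_gx_gy (a b : 'I_d.+1) j : (gx b j).[a%:R] = (gy a j).[b%:R].
Proof.
rewrite -horner_evalE -[b%:R in RHS](rmorph_nat (horner_eval (a%:R : B))).
by rewrite horner_map.
Qed.

Lemma sum_gx b : \sum_j gx b j ^+ m = (nodal B b%:R b ^+ m)%:P * nodal _ 'X b ^+ m.
Proof.
transitivity (\sum_j g j ^+ m).[b%:R].
  by rewrite horner_sum; apply: eq_bigr => j _; rewrite horner_exp.
rewrite sum_g horner_sum (bigD1 b) //= big1 => [|i ne]; last first.
  by rewrite horner_exp hornerM horner_nodal nodal_eq0 1?eq_sym // mulr0 expr0n gtn_eqF.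
rewrite addr0 horner_exp hornerM horner_nodal -(rmorph_nodal _ _ polyC) hornerC exprMn mulrC.
by rewrite -[b%:R](rmorph_nat polyC) -rmorph_nodal -rmorphXn.
Qed.

Lemma sum_gy a : \sum_j gy a j ^+ m = (nodal B a%:R a ^+ m)%:P * nodal _ 'X a ^+ m.
Proof.
transitivity (map_poly (horner_eval (a%:R : B)) (\sum_j g j ^+ m)).
  by rewrite rmorph_sum; apply: eq_bigr => j _; rewrite rmorphXn.
have Dnode i : map_poly (horner_eval (a%:R : B)) (nodal _ 'X%:P i * nodal _ 'X i) =
    (nodal B a%:R i)%:P * nodal _ 'X i.
  by rewrite rmorphM !rmorph_nodal /= map_polyX map_polyC /= horner_evalE hornerX.
rewrite sum_g rmorph_sum (bigD1 a) //= big1 => [|i ne]; last first.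
  by rewrite rmorphXn /= Dnode nodal_eq0 1?eq_sym // mul0r expr0n gtn_eqF.
by rewrite addr0 rmorphXn /= Dnode exprMn rmorphXn.
Qed.

(** For [i != b] the derivative keeps a factor [N_i(b) ^+ m.-1], which is 0 because [m > 1]. Only
    the term [i = b] survives, with its factor [N_b(x) ^+ m]. *)
Lemma sum_gx_deriv (b : 'I_d.+1) : exists c : {poly B},
  \sum_j (g j)^`().[b%:R] * gx b j ^+ m.-1 *+ m = c * nodal _ 'X b ^+ m.
Proof.
pose N := nodal {poly {poly B}} 'X.
exists ((N b)^`().[b%:R] * (N b).[b%:R] ^+ m.-1 *+ m).
transitivity (\sum_j g j ^+ m)^`().[b%:R].
  rewrite (linear_sum deriv) /= horner_sum; apply: eq_bigr => j _.
  by rewrite deriv_exp hornerMn hornerM horner_exp.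
rewrite sum_g (linear_sum deriv) /= horner_sum (bigD1 b) //= big1 => [|i ne]; last first.
  rewrite deriv_exp hornerMn hornerM horner_exp hornerM [(nodal _ 'X i).[_]]horner_nodal.
  rewrite nodal_eq0 1?eq_sym // mulr0 expr0n.
  by rewrite gtn_eqF ?mulr0 ?mul0rn // -ltnS prednK.
have -> : nodal {poly {poly B}} 'X%:P b = (nodal _ 'X b)%:P by rewrite rmorph_nodal.
rewrite addr0 exprMn -rmorphXn /= mul_polyC derivZ hornerZ deriv_exp hornerMn hornerM.
by rewrite horner_exp mulrC.
Qed.

Lemma nodal_powers_neq0 j : g j != 0.
Proof.
have /fin_all_exists[h Dh] b : exists h, forall j, gx b j = (h j)%:P * nodal _ 'X b.
  apply: (fin_all_exists (P := fun j c => gx b j = c%:P * nodal _ 'X b)).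
  by rewrite nodalX; apply: sum_powers_divides; rewrite -nodalX; apply: sum_gx.
have /fin_all_exists[k Dk] a : exists k, forall j, gy a j = (k j)%:P * nodal _ 'X a.
  apply: (fin_all_exists (P := fun j c => gy a j = c%:P * nodal _ 'X a)).
  by rewrite nodalX; apply: sum_powers_divides; rewrite -nodalX; apply: sum_gy.
(* Both restrictions agree at the point (a, a), where [N_a(a)] cancels. *)
have eq_hk a i : h a i = k a i.
  apply: (nodal_lreg a); rewrite ![nodal _ _ _ * _]mulrC.
  have := horner_gx_gy a a i.
  by rewrite Dh Dk !hornerM !hornerC !horner_nodal.
pose H : 'M[B]_d.+1 := \matrix_(b, i) h b i ^+ m.-1.
pose K : 'M[B]_d.+1 := \matrix_(i, a) k a i.
have HK0 b a : b != a -> (H *m K) b a = 0.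
  move=> ne; have [c Dc] := sum_gx_deriv b.
  (* Dividing by [N_b(x) ^+ m.-1] leaves one factor [N_b(x)] on the right, which vanishes at x =
     a. *)
  have {}Dc : \sum_i (g i)^`().[b%:R] * (h b i ^+ m.-1)%:P *+ m = c * nodal _ 'X b.
    apply: (@lregX _ _ m.-1 (monic_lreg (monic_nodal B b))).
    rewrite mulrCA -exprSr prednK // -Dc mulr_sumr; apply: eq_bigr => i _.
    by rewrite Dh exprMn rmorphXn /= mulrnAr mulrCA (mulrC (nodal _ _ _ ^+ _)).
  have regm : GRing.lreg (m%:R : B) by rewrite -(prednK m_gt0); apply: natr_lreg.
  apply: (deriv_nodal_lreg a b ne); apply: regm; rewrite !mulr0.
  have := congr1 (horner_eval (a%:R : B)) Dc.
  rewrite [RHS]rmorphM /= [horner_eval _ (nodal _ _ _)]horner_nodal nodal_eq0 1?eq_sym // mulr0 => <-.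
  rewrite rmorph_sum mxE !mulr_sumr; apply: eq_bigr => i _.
  rewrite rmorphMn rmorphM /= [horner_eval _ (_%:P)]hornerC.
  (* Setting x = a commutes with differentiating in y, so the derivative of [g i] at (a, b) is
     [k a i] times [N_a'(b)]. *)
  have -> : horner_eval (a%:R : B) (g i)^`().[b%:R] = (gy a i)^`().[b%:R].
    by rewrite deriv_map -[b%:R in RHS](rmorph_nat (horner_eval (a%:R : B))) horner_map.
  rewrite Dk derivM derivC mul0r add0r hornerM hornerC !mxE -[RHS]mulr_natl.
  by congr (_ * _); rewrite mulrC (mulrC (h b i ^+ _)) mulrAC.
have HKr a : GRing.lreg ((H *m K) a a).
  (* As [h a i = k a i], the entry is the sum of the [h a i ^+ m], read off from [sum_gx] at x =
     a. *)
  have -> : (H *m K) a a = nodal B a%:R a ^+ m.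
    apply: (@lregX _ _ m (nodal_lreg a)).
    have := congr1 (horner_eval (a%:R : B)) (sum_gx a).
    rewrite [RHS]rmorphM /= [horner_eval _ (_%:P)]hornerC rmorphXn /=.
    rewrite [horner_eval _ (nodal _ _ _)]horner_nodal => <-.
    rewrite rmorph_sum mxE mulr_sumr; apply: eq_bigr => i _.
    rewrite rmorphXn /= Dh rmorphM /= [horner_eval _ (_%:P)]hornerC.
    rewrite [horner_eval _ (nodal _ _ _)]horner_nodal !mxE -eq_hk -exprSr prednK //.
    by rewrite exprMn mulrC.
  exact/lregX/nodal_lreg.
(* If [g j = 0], then every [h a j], hence row [j] of [K], is 0. *)
apply: contra_neq (diag_mx_singular _ _ H K j HK0 HKr) => gj0.
apply/rowP => a; rewrite !mxE -eq_hk; apply: (nodal_lreg a).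
have := congr1 (horner_eval (a%:R : B)) (Dh a j).
rewrite /gx gj0 horner0 rmorphM /= ![horner_eval _ (_%:P)]hornerC.
by rewrite [horner_eval _ (nodal _ _ _)]horner_nodal mulr0 mulrC => <-.
Qed.
End Nodes.
End Anisotropic.

(** * Transfer to polynomials in n variables *)

Lemma sum_nth_pad (R : comNzRingType) (m k : nat) (l : seq R) :
  (0 < m)%N -> (size l <= k)%N -> \sum_(j < k) l`_j ^+ m = \sum_(y <- l) y ^+ m.
Proof.
move=> m_gt0 le_lk; rewrite (big_nth 0) -(big_mkord xpredT (fun j => l`_j ^+ m)).
rewrite (big_cat_nat (leq0n (size l)) le_lk) /= [X in _ + X]big_nat_cond.
rewrite [X in _ + X]big1 ?addr0 // => j /andP[/andP[le_lj _] _].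
by rewrite nth_default // expr0n gtn_eqF.
Qed.

Theorem mainTheorem3 (A : comNzRingType) (s n : nat)
  (hs : (1 <= s)%N) (hn : (1 < n)%N)
  (hA : ~ sum_of_powers 2 (-1 : A)) :
  pythagoras_infinite {mpoly A[n]} (2 * s)%N.
Proof.
move=> k _ bound.
have m_gt1 : (1 < 2 * s)%N by rewrite -[2%N]muln1 leq_mul.
have [B [phi B_aniso]] := anisotropic_quotient A hA s.
pose x0 : {mpoly A[n]} := 'X_(Ordinal (ltnW hn)).
pose x1 : {mpoly A[n]} := 'X_(Ordinal hn).
have [|l [size_l sum_l]] := bound (\sum_(i < k.+1) (nodal k _ x0 i * nodal k _ x1 i) ^+ (2 * s)).
  exists [seq nodal k _ x0 i * nodal k _ x1 i | i <- index_enum 'I_k.+1].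
  by rewrite big_map.
(* The first variable goes to x and all the others to y. *)
pose h (i : 'I_n) : {poly {poly B}} := if val i == 0%N then 'X%:P else 'X.
pose iota : {rmorphism A -> {poly {poly B}}} := polyC \o (polyC \o phi).
pose psi : {rmorphism {mpoly A[n]} -> {poly {poly B}}} := mmap iota h.
have psi0 : psi x0 = 'X%:P by rewrite /psi /= mmapX mmap1U.
have psi1 : psi x1 = 'X by rewrite /psi /= mmapX mmap1U.
have sum_psi : \sum_(j < k.+1) psi l`_j ^+ (2 * s) =
    \sum_i (nodal k _ 'X%:P i * nodal k _ 'X i) ^+ (2 * s).
  transitivity (psi (\sum_(j < k.+1) l`_j ^+ (2 * s))).
    by rewrite rmorph_sum; apply: eq_bigr => j _; rewrite rmorphXn.
  rewrite sum_nth_pad 1?ltnW // ?leqW // -sum_l rmorph_sum; apply: eq_bigr => i _.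
  by rewrite rmorphXn rmorphM !rmorph_nodal -psi0 -psi1.
(* [l] has at most [k] entries, so the entry at [ord_max], of index [k], is the default 0. *)
have := nodal_powers_neq0 B _ m_gt1 B_aniso k (fun j => psi l`_j) sum_psi ord_max.
by rewrite nth_default // rmorph0 eqxx.
Qed.
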